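(* Let $G$ be a finite group, $n$ a positive divisor of $\exp(G)$, and $(H,hH^{[n]})\in\mathcal{D}^{C_n}_G$ (i.e. $H\le G$ and $h\in H$). Then the element $$[N_G(H,hH^{[n]}):H^{[n]}]\,[H^{[n]}:H']_0\; e^{G,n}_{H,h}$$ of $B^{C_n}_{\mathbb{Q}[\zeta]}(G)$ belongs to $B^{C_n}_{\mathbb{Z}[\zeta]}(G)$.
   Context: $G$ is a finite group, $n$ a positive divisor of $\exp(G)$ (the exponent of $G$), $\zeta=e^{2\pi i/n}$, and $C_n=\langle\zeta\rangle\le\mathbb{C}^\times$. Notation: ${}^gH=gHg^{-1}$; for $\phi\in\mathrm{Hom}(H,C_n)$, ${}^g\phi\in\mathrm{Hom}({}^gH,C_n)$ is ${}^g\phi(x)=\phi(g^{-1}xg)$. $H'$ is the commutator subgroup. For a positive integer $m$, $m_0$ is the product of the distinct prime divisors of $m$. For a finite group $H$, $H^{[n]}$ is the smallest normal subgroup of $H$ such that $H/H^{[n]}$ is abelian with all elements of order dividing $n$; $H^{[n]}=\langle H',\{x^n : x\in H\}\rangle$. Fibered Burnside ring: let $\mathcal{M}^{C_n}_G$ be the set of pairs $(H,\phi)$ with $H\le G$, $\phi\in\mathrm{Hom}(H,C_n)$, on which $G$ acts by ${}^g(H,\phi)=({}^gH,{}^g\phi)$; $[H,\phi]_G$ denotes the orbit. $B^{C_n}(G)$ is the free abelian group on the set of orbits with multiplication $[H,\phi]_G[K,\psi]_G=\sum_{g\in[H\backslash G/K]}[H\cap{}^gK,\ \phi|_{H\cap{}^gK}\cdot({}^g\psi)|_{H\cap{}^gK}]_G$,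 where $[H\backslash G/K]$ is a set of double coset representatives. It is a commutative ring with identity $[G,1]_G$. For a commutative ring $R$, $B^{C_n}_R(G)=R\otimes B^{C_n}(G)$. $\mathcal{D}^{C_n}_G$ is the set of pairs $(H,hH^{[n]})$ with $H\le G$, $h\in H$, on which $G$ acts by conjugation; $[H,hH^{[n]}]_G$ is the orbit and $N_G(H,hH^{[n]})$ the stabilizer. For each such pair, the species $s^{G,n}_{H,h}$ is the ring homomorphism with $s^{G,n}_{H,h}([K,\phi]_G)=\sum_{gK\in G/K,\ H\le{}^gK}{}^g\phi(h)$, extended $\mathbb{Q}[\zeta]$-linearly to $B^{C_n}_{\mathbb{Q}[\zeta]}(G)$. The primitive idempotent $e^{G,n}_{H,h}\in B^{C_n}_{\mathbb{Q}[\zeta]}(G)$ is the unique element with $s^{G,n}_{K,k}(e^{G,n}_{H,h})=1$ if $[K,kK^{[n]}]_G=[H,hH^{[n]}]_G$ and $0$ otherwise, for all $(K,kK^{[n]})\in\mathcal{D}^{C_n}_G$. *)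

(* Defs.v *)
(* MathComp, with MathComp-Analysis for cos, sin, pi and real-closed for R[i]. *)
From HB Require Import structures.
From mathcomp Require Import all_boot all_order all_algebra all_fingroup.
From mathcomp Require Import all_solvable.
From mathcomp Require Import complex reals trigo.

Set Implicit Arguments.
Unset Strict Implicit.
Unset Printing Implicit Defensive.

Import GRing.Theory.
Local Open Scope ring_scope.

Definition zeta (R : realType) (n : nat) : R[i] :=
  (cos (2 * pi / n%:R) +i* sin (2 * pi / n%:R))%C.

Section Coefficients.

Variables (F : fieldType) (z : F).

Definition in_Qadj (a : F) : Prop :=
  exists p : {poly rat}, a = (map_poly ratr p).[z].

Definition in_Zadj (a : F) : Prop :=
  exists p : {poly int}, a = (map_poly intr p).[z].

End Coefficients.

(* The m_0 of the text. *)
Definition squarefree_part (m : nat) : nat := (\prod_(p <- primes m) p)%N.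

Section Residual.

Variables (gT : finGroupType) (n : nat).

(* H^[n] *)
Definition nresidual (H : {set gT}) : {set gT} :=
  <<H^`(1) :|: [set x ^+ n | x in H]>>%g.

Canonical nresidual_group (H : {set gT}) := [group of nresidual H].

(* The defining universal property of H^[n]. *)
Lemma nresidual_normal (H : {group gT}) : (nresidual H <| H)%g.
Proof.
have sub : (H^`(1) :|: [set x ^+ n | x in H] \subset H)%g.
  rewrite subUset der_sub; apply/subsetP=> _ /imsetP[x Hx ->].
  by rewrite groupX.
apply: sub_der1_normal; last by rewrite gen_subG.
exact: subset_trans (subsetUl _ _) (subset_gen _).
Qed.

Lemma nresidual_min (H N : {group gT}) : (N <| H)%g ->
  (nresidual H \subset N) = abelian (H / N)%g && (exponent (H / N)%g %| n)%N.
Proof.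
move=> /andP[_ nNH]; rewrite gen_subG subUset; congr (_ && _).
  by apply/idP/idP=> [/sub_der1_abelian | /(der1_min nNH)].
apply/subsetP/exponentP=> [sXN _ /morphimP[x Nx Hx ->] | expN].
  by rewrite -morphX //= coset_id // sXN //; apply: imset_f.
move=> _ /imsetP[x Hx ->]; have Nx := subsetP nNH x Hx.
by rewrite coset_idr ?groupX // morphX // expN // mem_morphim.
Qed.

(* The orbit [H, h H^[n]]_G. *)
Definition Dorbit (G H : {group gT}) (h : gT) : {set {set gT} * {set gT}} :=
  [set (H :^ g^-1, (h *: nresidual H) :^ g^-1)%g | g in G].

(* The stabilizer N_G(H, h H^[n]). *)
Definition Dstab (G H : {group gT}) (h : gT) : {set gT} :=
  ('N_G(H) :&: 'N(h *: nresidual H))%g.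

End Residual.

Section FiberedBurnside.

Variables (F : fieldType) (z : F) (n : nat).
Variables (gT : finGroupType) (G : {group gT}).

(* The group C_n = <z>, when z is an n-th root of unity, as a finite type. *)
Definition fiber : finType := seq_sub [seq z ^+ i | i <- iota 0 n].

(* A morphism H -> C_n is encoded as a function on gT equal to 1 outside H,  *)
(* so that equality of such functions is equality of morphisms on H.         *)
Definition fpair : finType := ({group gT} * {ffun gT -> fiber})%type.

Definition is_fpair (p : fpair) : bool :=
  [&& p.1 \subset G,
      [forall x in p.1, forall y in p.1,
         val (p.2 (x * y)%g) == val (p.2 x) * val (p.2 y)]
    & [forall (x | x \notin p.1), val (p.2 x) == 1]].

Definition fpairs : {set fpair} := [set p | is_fpair p].

(* The left action: conjg is a right action, x ^ g = g^-1 * x * g. *)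
Definition fconj (g : gT) (p : fpair) : fpair :=
  ((p.1 :^ g^-1)%G, [ffun x => p.2 (x ^ g)%g]).

Definition forbit (p : fpair) : {set fpair} := [set fconj g p | g in G].

Definition forbits : {set {set fpair}} := [set forbit p | p in fpairs].

(* B(G) with scalars extended to F; the extensions to smaller coefficient     *)
(* rings are the submodules cut out by fburnside_over.                        *)
Definition fburnside : zmodType := {ffun {o | o \in forbits} -> F}.

Definition fburnside_over (S : F -> Prop) (x : fburnside) : Prop :=
  forall o, S (x o).

Lemma forbit_rep (o : {o | o \in forbits}) :
  exists p, (p \in fpairs) && (val o == forbit p).
Proof. by case/imsetP: (valP o) => p Mp ->; exists p; rewrite Mp eqxx. Qed.

Definition frep (o : {o | o \in forbits}) : fpair := xchoose (forbit_rep o).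

Definition fspecies_pair (H : {group gT}) (h : gT) (p : fpair) : F :=
  \sum_(A in lcosets p.1 G | H \subset (fconj (repr A) p).1)
     val ((fconj (repr A) p).2 h).

Definition fspecies (H : {group gT}) (h : gT) (x : fburnside) : F :=
  \sum_o x o * fspecies_pair H h (frep o).

(* [H, phi]_G as an element of the ring. *)
Definition fbasis (p : fpair) : fburnside :=
  [ffun o => (val o == forbit p)%:R].

Lemma fconjM a b p : fconj a (fconj b p) = fconj (a * b)%g p.
Proof.
congr (_, _); first by apply/val_inj; rewrite /= invMg conjsgM.
by apply/ffunP=> x; rewrite !ffunE conjgM.
Qed.

Lemma fconj_stab p k : p \in fpairs -> k \in p.1 -> fconj k p = p.
Proof.
case: p => K f; rewrite inE /= => /and3P[_ /= fM f1] Kk.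
congr (_, _); first by apply/val_inj; rewrite /= conjGid ?groupV.
have fMK x y : x \in K -> y \in K ->
    val (f (x * y)%g) = val (f x) * val (f y).
  by move=> Kx Ky; move/forall_inP/(_ x Kx)/forall_inP/(_ y Ky)/eqP: fM.
apply/ffunP=> x; rewrite ffunE; apply/val_inj => /=.
have [Kx | nKx] := boolP (x \in K); last first.
  rewrite (eqP (forall_inP f1 _ nKx)) (eqP (forall_inP f1 _ _)) //.
  by rewrite memJ_norm ?(subsetP (normG K)).
have -> : (x ^ k = k^-1 * (x * k))%g by [].
rewrite fMK ?groupV ?groupM // fMK // mulrCA -fMK ?groupV // mulVg.
by rewrite -fMK ?group1 // mulg1.
Qed.

Lemma fconj_lcoset p g A : p \in fpairs -> A = (g *: p.1)%g ->
  fconj (repr A) p = fconj g p.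
Proof.
move=> Mp ->; have: repr (g *: p.1)%g \in (g *: p.1)%g.
  exact: mem_repr (lcoset_refl _ _).
case/lcosetP=> k Kk ->; rewrite -fconjM (fconj_stab Mp Kk). reflexivity.
Qed.

Lemma fconj_fpairs g p : g \in G -> p \in fpairs -> fconj g p \in fpairs.
Proof.
case: p => K f Gg; rewrite !inE /= => /and3P[/= sKG fM f1].
apply/and3P; split=> /=.
- by rewrite -(conjGid (groupVr Gg)) conjSg.
- apply/forall_inP=> x Kx; apply/forall_inP=> y Ky; rewrite !ffunE conjMg.
  by apply: (forall_inP (forall_inP fM _ _)); rewrite -mem_conjgV.
- apply/forall_inP=> x; rewrite mem_conjgV ffunE; exact: (forall_inP f1).
Qed.

Lemma fspecies_pair_fconj H h p a : a \in G -> p \in fpairs ->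
  fspecies_pair H h (fconj a p) = fspecies_pair H h p.
Proof.
move=> Ga Mp; have Map := fconj_fpairs Ga Mp.
pose r (A : {set gT}) := (A :* a)%g.
have rE g : r (g *: (fconj a p).1)%g = ((g * a) *: p.1)%g.
  apply/setP=> x; rewrite mem_rcoset !mem_lcoset /= mem_conjgV conjgE.
  by rewrite invMg !mulgA mulgKV.
have injr : injective r by apply: can_inj (rcosetK a).
have GA A : (r A \in lcosets p.1 G) = (A \in lcosets (fconj a p).1 G).
  apply/lcosetsP/lcosetsP=> [[g Gg rA] | [g Gg ->]].
    exists (g * a^-1)%g; first by rewrite groupM ?groupV.
    by apply: injr; rewrite rA rE mulgKV.
  by exists (g * a)%g; rewrite ?groupM ?rE.
have key A : A \in lcosets (fconj a p).1 G ->
    fconj (repr A) (fconj a p) = fconj (repr (r A)) p.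
  case/lcosetsP=> g Gg defA; rewrite (fconj_lcoset Map defA) fconjM.
  by rewrite (@fconj_lcoset p (g * a)%g (r A) Mp) // defA rE.
rewrite /fspecies_pair [RHS](reindex_inj injr); apply: eq_big => A.
  by rewrite GA; apply: andb_id2l => /key->.
by case/andP=> /key->.
Qed.

(* Hence the choice of representatives in fspecies is immaterial. *)
Lemma fspecies_basis H h p : p \in fpairs ->
  fspecies H h (fbasis p) = fspecies_pair H h p.
Proof.
move=> Mp; have Op : forbit p \in forbits by apply: imset_f.
pose op : {o | o \in forbits} := exist (fun o => o \in forbits) _ Op.
rewrite /fspecies (bigD1 op) //= big1 ?addr0 => [|o neq_o].
  rewrite ffunE eqxx mul1r; case/andP: (xchooseP (forbit_rep op)).
  rewrite -/(frep op) => Mr /eqP/= eq_o.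
  have: p \in forbit (frep op).
    rewrite -eq_o; apply/imsetP; exists 1%g => //; case: (p) => K f.
    congr (_, _); first by apply/val_inj; rewrite /= invg1 conjsg1.
    by apply/ffunP=> x; rewrite ffunE conjg1.
  by case/imsetP=> g Gg ->; rewrite fspecies_pair_fconj.
rewrite ffunE; case: eqP => [eq_o | _]; last by rewrite mul0r.
by case/eqP: neq_o; apply/val_inj.
Qed.

Definition is_primitive_idempotent (H : {group gT}) (h : gT)
    (e : fburnside) : Prop :=
  fburnside_over (in_Qadj z) e /\
  forall (K : {group gT}) (k : gT), K \subset G -> k \in K ->
    fspecies K k e = (Dorbit n G K k == Dorbit n G H h)%:R.

End FiberedBurnside.

(* Main.v *)
Require Import Defs.
From HB Require Import structures.
From mathcomp Require Import all_boot all_order all_algebra all_fingroup.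
From mathcomp Require Import all_solvable all_field all_character ring.
From mathcomp Require Import complex reals trigo.

(** Write [N] for the residual of [H], [mu] for the Moebius function of the
    subgroup lattice, and [H'] for the commutator subgroup.

    Moebius inversion over subgroups combined with Fourier inversion over
    [Hom(H, C_n)] gives the explicit formula
      [N_G(H, hN) : N] e
        = 1/|H| sum_(K <= H) |K| mu(K, H) sum_phi phi(h)^-1 [K, phi|_K],
    where [phi] runs over [Hom(H, C_n)].  The right-hand side is
    [scaled_idem]; its species are computed in [fspecies_scaled_idem].  For a
    subgroup [L], the Moebius sum keeps only the [g] that conjugate [L] onto
    [H], and orthogonality of characters ([sum_homs]) keeps among these the
    ones that also carry [l] into [hN]; they form a coset of [N_G(H, hN)], or
    there are none.  An element is determined by its species because, on a
    subgroup of maximal order in its support, the species are linear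
    combinations of characters with the coefficients of the element
    ([fspecies_inj]).

    For integrality, collect the terms of one orbit.  The [phi] with a
    prescribed restriction to [K] form a coset of [Hom(H / KN, C_n)], so the
    sum of [phi(h)^-1] over them is zero or [[H : KN]] times a root of unity
    ([sum_hres_fiber]).  The [[H : N_H(K)]] conjugates of [K] in [H]
    contribute equally.  Together they yield
      mu(K, H) [H : KN] / [N_H(K) : K]
    times an element of [Z[zeta]].  By a theorem of Hawkes, Isaacs and
    Ozaydin ([mobius_index_dvd]), [[N_H(K) : K]] divides
    [mu(K, H) [H : H'K]_0], and [[H : H'K]_0] divides [[H : KN] [N : H']_0],
    because [[H : H'K] = [H : KN] [KN : H'K]] and [[KN : H'K]] divides
    [[N : H']] ([index_squarefree_dvd]).

    The theorem on [mu] comes from counting the [g] in [N_G(K)] with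
    [<K, g> = G] in two ways.  Moebius inversion gives
    [sum_(K <= L <= G) mu(L, G) |N_G(K) :&: L|].  On the other hand there is no
    such [g] unless [K] is normal in [G] with [G / K] cyclic of some order
    [r], and then there are [|K| totient(r)] of them, where [r] divides
    [r_0 totient(r)].  In the sum, the terms with [L <> K] are under control
    by induction once they are grouped into [N_G(K)]-orbits, which leaves the
    term of [K]. *)

Set Implicit Arguments.
Unset Strict Implicit.
Unset Printing Implicit Defensive.

Import Order.TTheory GRing.Theory Num.Theory.
Local Open Scope ring_scope.

(** * Squarefree parts *)

Lemma squarefree_part_dvdP a m :
  (forall p, prime p -> (0 < a)%N -> (p %| a)%N -> (p %| m)%N) ->
  (squarefree_part a %| m)%N.
Proof.
move=> dvm; have: all (fun p => prime p && (p %| m)%N) (primes a).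
  by apply/allP=> p; rewrite mem_primes => /and3P[pr_p a0 pa]; rewrite pr_p dvm.
rewrite /squarefree_part; elim: (primes a) (primes_uniq a) => [|p s IHs] /=.
  by rewrite big_nil dvd1n.
case/andP=> s'p Us /andP[/andP[pr_p pm] prs]; rewrite big_cons Gauss_dvd.
  by rewrite pm IHs.
rewrite prime_coprime // Euclid_dvd_prod // big_has_cond -all_predC.
apply/allP=> q sq /=; rewrite dvdn_prime2 //; last by case/andP: (allP prs q sq).
by apply: contraNneq s'p => ->.
Qed.

Lemma dvdn_squarefree_part p a :
  prime p -> (0 < a)%N -> (p %| a)%N -> (p %| squarefree_part a)%N.
Proof.
move=> pr_p a0 pa; rewrite /squarefree_part (big_rem p) /= ?dvdn_mulr //.
by rewrite mem_primes pr_p a0.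
Qed.

Lemma squarefree_part_dvd a b : (0 < b)%N -> (a %| b)%N ->
  (squarefree_part a %| squarefree_part b)%N.
Proof.
move=> b0 dvab; apply: squarefree_part_dvdP => p pr_p _ pa.
by apply: dvdn_squarefree_part => //; apply: dvdn_trans dvab.
Qed.

(** Here [r = prod p ^ a] while [r_0 totient(r) = prod p (p - 1) p ^ (a - 1)]. *)
Lemma dvdn_squarefree_totient r : (0 < r)%N ->
  (r %| squarefree_part r * totient r)%N.
Proof.
move=> r0; rewrite totientE // /squarefree_part; apply/dvdnP.
exists (\prod_(p <- primes r) p.-1)%N.
rewrite big_split mulnCA; congr (_ * _)%N.
rewrite -big_split /=.
rewrite [RHS](prod_prime_decomp r0) prime_decompE big_map.
rewrite !big_seq; apply: eq_bigr => p; rewrite -logn_gt0 => lt0 /=.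
by rewrite -expnS prednK.
Qed.

(** * Sums over conjugation-invariant families of subgroups *)

Section Mobius.
Variable gT : finGroupType.
Implicit Types G H K L A : {group gT}.

(** The additive property [P] stands for membership in a lattice (multiples of
    an integer, or [Z[zeta]]): the index [[A : N_A(K)]], which is the length of
    the orbit of [K], supplies the missing divisibility of a single term. *)
Lemma sum_conj_invariant (V : nmodType) (P : V -> Prop) A
    (D : pred {group gT}) (f : {group gT} -> V) :
  P 0 -> (forall u v, P u -> P v -> P (u + v)) ->
  (forall K x, x \in A -> D K -> D (K :^ x)%G) ->
  (forall K x, x \in A -> D K -> f (K :^ x)%G = f K) ->
  (forall K, D K -> P (f K *+ #|A : 'N_A(K)|%g)) ->
  P (\sum_(K | D K) f K).
Proof.
move=> P0 Padd DJ fJ Pf; pose S := [set K | D K].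
have actS : [acts A, on S | 'JG].
  apply/actsP=> x Ax K; rewrite !inE; apply/idP/idP; last exact: DJ.
  move/(DJ _ x^-1%g); rewrite groupV => /(_ Ax).
  by congr (D _ = _); apply/val_inj; rewrite /= conjsgK.
have -> : \sum_(K | D K) f K = \sum_(K in S) f K.
  by apply: eq_bigl => K; rewrite inE.
have /and3P[/eqP defS tiS _] := orbit_partition actS.
rewrite -defS big_trivIset //=; apply: (big_ind P) => // B /imsetP[K].
rewrite inE => DK ->{B}; rewrite (eq_bigr (fun=> f K)) => [|_ /orbitP[x Ax <-]].
  by rewrite sumr_const card_orbit astab1JG; apply: Pf.
exact: fJ.
Qed.

(** * The Moebius function of the subgroup lattice *)

(** The fuel [d] bounds the length of the chains from [K] up to [G]. *)
Fixpoint mobius_rec (d : nat) G K : int :=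
  if d is d'.+1 then
    (K == G)%:R -
      \sum_(L : {group gT} | (K \proper L) && (L \subset G)) mobius_rec d' G L
  else 0.

Definition mobius K G : int := mobius_rec #|G|.+1 G K.

Lemma mobius_recE d G K : (#|G| - #|K| < d)%N -> mobius_rec d G K = mobius K G.
Proof.
suff stab d1 d2 L : (#|G| - #|L| < d1)%N -> (#|G| - #|L| < d2)%N ->
    mobius_rec d1 G L = mobius_rec d2 G L.
  by move=> ltd; apply: stab; rewrite // ltnS leq_subr.
elim: d1 d2 L => [|d1 IHd] [|d2] L //= lt1 lt2.
congr (_ - _); apply: eq_bigr => M /andP[/proper_card ltLM /subset_leq_card leMG].
have ltd: (#|G| - #|M| < #|G| - #|L|)%N by rewrite ltn_sub2l // (leq_trans ltLM).
by apply: IHd; apply: leq_trans ltd _.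
Qed.

Lemma sum_mobius K G : K \subset G ->
  \sum_(L : {group gT} | (K \subset L) && (L \subset G)) mobius L G = (K == G)%:R.
Proof.
move=> sKG; rewrite (bigD1 K) ?subxx //= {1}/mobius /=.
set s1 := \sum_(L | _) _; set s2 := \sum_(L | _) _.
suff -> : s1 = s2 by rewrite subrK.
rewrite /s2; apply: eq_big => [L|L /andP[ltKL sLG]]; last first.
  apply: mobius_recE; rewrite ltn_subrL cardG_gt0 //=.
rewrite properEneq eq_sym -andbA andbC; congr (_ && _).
Qed.

Lemma mobiusJ K G x : x \in 'N(G)%g -> mobius (K :^ x)%G G = mobius K G.
Proof.
move=> nGx; rewrite /mobius; move: #|G|.+1 => d.
elim: d K => //= d IHd K.
have eqJ (L : {group gT}) : (L :^ x == G :> {set gT})%g = (L == G :> {set gT})%g.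
  by rewrite -{1}(normP nGx) (inj_eq (@conjsg_inj _ x)).
congr (_%:R - _).
  by congr nat_of_bool; apply: eqJ.
rewrite (reindex_inj (h := fun L : {group gT} => (L :^ x)%G)) /=; last first.
  by move=> L M /(congr1 val)/= /conjsg_inj/val_inj.
apply: eq_big => [L|L _]; last exact: IHd.
by rewrite properJ -{1}(normP nGx) conjSg.
Qed.

(** If some [g] normalizing [K] generates [G] together with [K], then [K] is
    normal in [G] and [G / K] is cyclic, so [K] contains [G'], and the [g] in
    question are the elements of the cosets that generate [G / K]. *)
Lemma card_norm_gen K G : K \subset G ->
  (#|'N_G(K)%g| %| squarefree_part #|G : G^`(1) <*> K|%g *
     #|[set g in 'N_G(K)%g | K <*> <[g]> == G]%g|)%N.
Proof.
move=> sKG; set c := [set g in _ | _].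
have [-> | [g0]] := set_0Vmem c; first by rewrite cards0 muln0 dvdn0.
rewrite 2!inE => /andP[/andP[Gg0 nKg0] /eqP defG].
have nKG: G \subset 'N(K)%g.
  by rewrite -defG join_subG normG cycle_subG.
have nsKG : (K <| G)%g by apply/andP.
have -> : ('N_G(K) = G)%g by apply/setIidPl.
have cycQ : (G / K = <[coset K g0]>)%g.
  by rewrite -defG quotientYidl ?cycle_subG // quotient_cycle.
have sG'K : G^`(1)%g \subset K.
  by apply: der1_min => //; rewrite cycQ cycle_abelian.
have -> : #|c| = (#|K| * totient #|G : K|%g)%N.
  rewrite -(card_quotient nKG) cycQ totient_gen -cycQ.
  pose C := [set x | generator (G / K)%g x].
  have genE g : g \in G -> (K <*> <[g]> == G)%g = (coset K g \in C).
    move=> Gg; have nKg := subsetP nKG g Gg.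
    rewrite inE /generator -quotient_cycle // -(quotientYidl (G := <[g]>)) ?cycle_subG //.
    rewrite eq_sym; apply/eqP/eqP => [-> // | /quotient_inj]; last first.
    by apply; rewrite ?normalYl ?cycle_subG.
  rewrite -sum1_card (partition_big (coset K) (mem C)) /=; last first.
    by move=> g; rewrite inE => /andP[/setIP[Gg _]]; rewrite genE.
  rewrite (eq_bigr (fun=> #|K|)) ?sum_nat_const 1?mulnC // => B.
  have [g Ng ->] := cosetP B => CB.
  rewrite sum1dep_card -(card_lcoset K g) -[(g *: K)%g]norm_rlcoset // -val_coset //.
  rewrite -cosetpre_set1_coset; apply: eq_card => x.
  apply/setIdP/morphpreP=> [[/setIdP[/setIP[Gx nKx] _] /eqP eqx] | [nKx /set1P eqx]].
    by split=> //; apply/set1P.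
  have CBx : coset K x \in C by rewrite [coset K x]eqx.
  have Gx : x \in G.
    rewrite -(quotientGK nsKG) mem_morphpre //=.
    by move: CBx; rewrite inE => /eqP->; apply: cycle_id.
  by rewrite [x \in c]inE in_setI Gx nKx genE // CBx [coset K x]eqx eqxx.
have -> : (G^`(1) <*> K = K)%g by apply/joing_idPr.
rewrite -(Lagrange sKG) mulnCA dvdn_pmul2l //.
exact: dvdn_squarefree_totient.
Qed.

(** Exchanging the sums, each [g] contributes the sum of [mu(L, G)] over the [L]
    above [<K, g>], which vanishes unless [<K, g> = G]. *)
Lemma sum_mobius_card K G : K \subset G ->
  \sum_(L : {group gT} | (K \subset L) && (L \subset G))
      mobius L G *+ #|'N_G(K) :&: L|%g =
    #|[set g in 'N_G(K)%g | K <*> <[g]> == G]%g|%:Z.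
Proof.
move=> sKG.
transitivity (\sum_(g in 'N_G(K)%g)
    \sum_(L : {group gT} | (K <*> <[g]> \subset L)%g && (L \subset G)) mobius L G).
  rewrite (exchange_big_dep (fun L : {group gT} => (K \subset L) && (L \subset G))) /=.
    apply: eq_bigr => L /andP[sKL sLG]; rewrite sumr_const; congr (_ *+ _).
    apply: eq_card => g; rewrite in_setI [RHS]unfold_in join_subG cycle_subG.
    by rewrite sKL sLG andbT.
  by move=> g L _; rewrite join_subG -andbA => /and3P[-> _ ->].
rewrite -sum1_card -[RHS]natz natr_sum big_mkcond [RHS]big_mkcond /=.
apply: eq_bigr => g _; rewrite !in_set.
case: ifP => // /andP[Gg _].
rewrite sum_mobius ?join_subG ?sKG ?cycle_subG //=.
by rewrite -val_eqE; case: eqP.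
Qed.

(** A theorem of Hawkes, Isaacs and Ozaydin, by downward induction on [K].  With
    [S = N_G(K)], [sum_mobius_card] and [card_norm_gen] show that [|S|] divides
    [m] times the sum of the [mu(L, G) |S :&: L|].  The orbit of [L] under [S]
    contributes a multiple of [|S|] as soon as [K < L], because [|S|] is the
    product of [|S :&: L|], [[N_S(L) : S :&: L]] and [[S : N_S(L)]], and the
    middle factor divides [[N_G(L) : L]]. *)
Theorem mobius_index_dvd K G : K \subset G ->
  (#|'N_G(K) : K|%g %| `|mobius K G| * squarefree_part #|G : G^`(1) <*> K|%g)%N.
Proof.
have [d] := ubnP (#|G| - #|K|)%N; elim: d K => // d IHd K led sKG.
set S := ('N_G(K))%G; set m := squarefree_part _.
have sKS : K \subset S by rewrite subsetI sKG normG.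
pose f (L : {group gT}) : int := (mobius L G *+ #|S :&: L|%g) *+ m.
have sumf : (#|S| %| \sum_(L : {group gT} | (K \subset L) && (L \subset G)) f L)%Z.
  rewrite sumrMnl sum_mobius_card // -mulr_natr mulrC.
  by rewrite natz -PoszM dvdzE /=; apply: card_norm_gen.
have absf L : `|f L|%N = (`|mobius L G| * #|S :&: L|%g * m)%N.
  rewrite /f -[LHS]/(`|_ *+ m|%N) -[_ *+ m]mulr_natr -[_ *+ #|_|]mulr_natr.
  by rewrite !natz !abszM.
rewrite (bigD1 K) ?subxx //= in sumf.
suff dvd_rest : (#|S| %| \sum_(L : {group gT} |
    (K \subset L) && (L \subset G) && (L != K)) f L)%Z.
  move: sumf; rewrite rpredDr //.
  rewrite dvdzE absf /= (setIidPr sKS) -(Lagrange sKS) mulnAC mulnC.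
  by rewrite dvdn_pmul2r ?cardG_gt0.
apply: (@sum_conj_invariant _ (fun u => #|S| %| u)%Z S) => [||L x Sx|L x Sx _|L].
- exact: dvdz0.
- exact: rpredD.
- have [Gx nKx] := setIP Sx.
  case/andP=> /andP[sKL sLG] neq.
  rewrite -{1}(normP nKx) -{1}(conjGid Gx) !conjSg sKL sLG /=.
  apply: contraNneq neq => /(congr1 val)/= eqK; apply/eqP/val_inj/(@conjsg_inj _ x).
  by rewrite /= eqK (normP nKx).
- have [Gx _] := setIP Sx.
  congr (_ *+ _ *+ _); first by rewrite mobiusJ // (subsetP (normG G)).
  by rewrite -[in LHS](conjGid Sx) -conjIg cardJg.
case/andP=> /andP[sKL sLG] neqLK.
have ltKL : (#|K| < #|L|)%N.
  by apply: proper_card; rewrite properEneq sKL eq_sym andbT.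
have /IHd/(_ sLG) IHL : (#|G| - #|L| < d)%N.
  rewrite ltnS in led; apply: leq_trans led; apply: ltn_sub2l => //.
  exact: leq_trans ltKL (subset_leq_card sLG).
(* the squarefree part attached to L divides m, the one attached to K *)
have {IHL} : (#|'N_G(L) : L|%g %| `|mobius L G| * m)%N.
  apply: dvdn_trans IHL _; apply: dvdn_mul => //; apply: squarefree_part_dvd => //.
  by apply: indexgS; rewrite genS // setUS.
have : (#|'N_S(L) : L|%g %| #|'N_G(L) : L|%g)%N.
  rewrite -!card_quotient ?subsetIr //; apply/cardSg/quotientS.
  by rewrite setSI ?subsetIl.
move=> /dvdn_trans/[apply] dvL.
have cardS : #|S| = (#|S :&: L| * #|'N_S(L) : L|%g * #|S : 'N_S(L)|%g)%N.
  rewrite -(Lagrange (subsetIl S 'N(L)%g)) -(LagrangeI ('N_S(L))%G L) /=.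
  by rewrite -setIA (setIidPr (normG L)).
have -> : (#|S| %| f L *+ #|S : 'N_S(L)|%g)%Z =
    (#|S| %| #|S :&: L| * (`|mobius L G| * m) * #|S : 'N_S(L)|%g)%N.
  by rewrite dvdzE -mulr_natr natz abszM absf [in RHS]mulnA [in RHS](mulnC #|_|).
by rewrite cardS dvdn_pmul2r ?indexg_gt0 // dvdn_pmul2l ?cardG_gt0.
Qed.

End Mobius.

(** * Homomorphisms to the group of roots of unity *)

Section RootOfUnity.
Variable R : realType.

Lemma zetaX n k : (0 < n)%N ->
  zeta R n ^+ k = (cos (2 * pi / n%:R * k%:R) +i* sin (2 * pi / n%:R * k%:R))%C.
Proof.
move=> n0; elim: k => [|k IHk]; first by rewrite mulr0 cos0 sin0.
rewrite exprSr IHk /zeta; set t := 2 * pi / n%:R.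
have -> : t * k.+1%:R = t * k%:R + t by rewrite -natr1 mulrDr mulr1.
by rewrite cosD sinD; congr (_ +i* _)%C; rewrite addrC.
Qed.

(** A power [cos (2x) + i sin (2x)], with [x] strictly between [0] and [pi], is
    not [1] because [cos (2x) = 1 - 2 sin(x)^2] and [sin x] is positive. *)
Lemma zeta_prim n : (0 < n)%N -> n.-primitive_root (zeta R n).
Proof.
move=> n0; have n0R : n%:R != 0 :> R by rewrite pnatr_eq0 -lt0n.
apply/andP; split=> //; apply/forallP=> /= i; rewrite unity_rootE zetaX //.
have [->|neq] := eqVneq i.+1 n.
  by rewrite mulfVK // mulr_natl cos2pi sin2pi eqxx.
have lt_in : (i.+1 < n)%N by rewrite ltn_neqAle neq ltn_ord.
rewrite eqbF_neg; apply/eqP => -[cos1 _]; pose x : R := pi / n%:R * i.+1%:R.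
have : 0 < sin x.
  apply: sin_gt0_pi; rewrite /x mulrAC -mulrA; apply/andP; split.
    by rewrite mulr_gt0 ?pi_gt0 // divr_gt0 ?ltr0n.
  by rewrite gtr_pMr ?pi_gt0 // ltr_pdivrMr ?ltr0n // mul1r ltr_nat.
rewrite lt_neqAle eq_sym => /andP[/negP[]]; rewrite -sqrf_eq0.
have -> : sin x ^+ 2 = 1 - cos x ^+ 2 by rewrite -sin2cos2.
have Ex : 2 * pi / n%:R * i.+1%:R = x *+ 2 by rewrite /x -[RHS]mulr_natl !mulrA.
move: cos1; rewrite Ex cos_mulr2n => /eqP.
by rewrite subr_eq -mulr2n eqr_pMn2r // => /eqP->; rewrite subrr.
Qed.

End RootOfUnity.

Section Homs.
Variables (F : numFieldType) (z : F) (n : nat).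
Hypothesis zP : n.-primitive_root z.

Lemma mem_fiber k : z ^+ k \in [seq z ^+ i | i <- iota 0 n].
Proof.
apply/mapP; exists (k %% n)%N; last by rewrite (prim_expr_mod zP).
by rewrite mem_iota /= add0n ltn_mod (prim_order_gt0 zP).
Qed.

Definition fpow k : fiber z n := SeqSub (mem_fiber k).

Lemma fiberP (u : fiber z n) : exists k, val u = z ^+ k.
Proof. by have /mapP[k _ ->] := valP u; exists k. Qed.

(** Multiplication and inversion of roots of unity as elements of the finite type
    [fiber]; the default value of [insubd] is never reached when [z] is a root
    of unity, by [val_fmul] and [val_finv]. *)
Definition fmul (u v : fiber z n) : fiber z n := insubd u (val u * val v).
Definition finv (u : fiber z n) : fiber z n := insubd u (val u)^-1.

Lemma val_fmul u v : val (fmul u v) = val u * val v.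
Proof.
rewrite val_insubd; have [i ->] := fiberP u; have [j ->] := fiberP v.
by rewrite -exprD mem_fiber.
Qed.

Lemma fiber_neq0 (u : fiber z n) : val u != 0.
Proof.
have [i ->] := fiberP u; rewrite expf_neq0 //.
apply: contra_eqN (prim_expr_order zP) => /eqP->.
by rewrite expr0n gtn_eqF ?(prim_order_gt0 zP) // eq_sym oner_eq0.
Qed.

Lemma val_finv u : val (finv u) = (val u)^-1.
Proof.
rewrite val_insubd; have [/= i def_u] := fiberP u.
have -> : (val u)^-1 = z ^+ (i * n.-1).
  apply: (mulfI (fiber_neq0 u)); rewrite divff ?fiber_neq0 //= def_u -exprD.
  by rewrite -mulnS prednK ?(prim_order_gt0 zP) // mulnC exprM (prim_expr_order zP) expr1n.
by rewrite mem_fiber.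
Qed.

Lemma fiberX (u : fiber z n) : val u ^+ n = 1.
Proof. by have [i ->] := fiberP u; rewrite exprAC (prim_expr_order zP) expr1n. Qed.

Variable gT : finGroupType.
Implicit Types (G H K L M : {group gT}) (f p q : {ffun gT -> fiber z n}).

(** [Hom(H, C_n)], in the encoding of the second components of [fpairs]: the
    functions take the value [1] outside [H]. *)
Definition homs H : {set {ffun gT -> fiber z n}} := [set f | (H, f) \in fpairs z n H].

Lemma homsP H f : reflect
  ({in H &, {morph (fun x => val (f x)) : x y / (x * y)%g >-> x * y}} /\
   forall x, x \notin H -> val (f x) = 1)
  (f \in homs H).
Proof.
rewrite 2!inE /is_fpair /= subxx /=.
apply: (iffP andP) => -[fM f1]; split.
- by move=> x y Hx Hy; apply/eqP/(forall_inP (forall_inP fM _ _)).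
- by move=> x Hx; apply/eqP/(forall_inP f1).
- by apply/forall_inP=> x Hx; apply/forall_inP=> y Hy; apply/eqP/fM.
by apply/forall_inP=> x Hx; apply/eqP/f1.
Qed.

Lemma fpairsE G K f : ((K, f) \in fpairs z n G) = (K \subset G) && (f \in homs K).
Proof. by rewrite [f \in _]inE !(inE, unfold_in) /is_fpair /= subxx. Qed.

Definition hone : {ffun gT -> fiber z n} := [ffun=> fpow 0].
Definition hmul p q : {ffun gT -> fiber z n} := [ffun x => fmul (p x) (q x)].
Definition hinv p : {ffun gT -> fiber z n} := [ffun x => finv (p x)].

Lemma val_hone x : val (hone x) = 1. Proof. by rewrite ffunE. Qed.
Lemma val_hmul p q x : val (hmul p q x) = val (p x) * val (q x).
Proof. by rewrite ffunE val_fmul. Qed.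
Lemma val_hinv p x : val (hinv p x) = (val (p x))^-1.
Proof. by rewrite ffunE val_finv. Qed.

Lemma hone_homs H : hone \in homs H.
Proof. by apply/homsP; split=> [x y _ _|x _]; rewrite !val_hone ?mulr1. Qed.

Lemma hmul_homs H p q : p \in homs H -> q \in homs H -> hmul p q \in homs H.
Proof.
move=> /homsP[pM p1] /homsP[qM q1]; apply/homsP; split=> [x y Hx Hy|x Hx].
  by rewrite /= !val_hmul pM // qM // mulrACA.
by rewrite val_hmul p1 // q1 // mulr1.
Qed.

Lemma hinv_homs H p : p \in homs H -> hinv p \in homs H.
Proof.
move=> /homsP[pM p1]; apply/homsP; split=> [x y Hx Hy|x Hx].
  by rewrite /= !val_hinv pM // invfM.
by rewrite val_hinv p1 // invr1.
Qed.

Lemma hmulKV p : cancel (hmul p) (hmul (hinv p)).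
Proof.
move=> q; apply/ffunP=> x; apply/val_inj.
by rewrite !val_hmul val_hinv mulKf ?fiber_neq0.
Qed.

Section OneHom.
Variables (H : {group gT}) (f : {ffun gT -> fiber z n}).
Hypothesis Hf : f \in homs H.

Lemma homM : {in H &, forall x y, val (f (x * y)%g) = val (f x) * val (f y)}.
Proof. by case/homsP: Hf. Qed.

Lemma hom_out x : x \notin H -> val (f x) = 1.
Proof. by case/homsP: Hf => _; apply. Qed.

Lemma hom1 : val (f 1%g) = 1.
Proof.
by apply: (mulfI (fiber_neq0 (f 1%g))); rewrite -homM ?group1 // mulg1 mulr1.
Qed.

Lemma homV x : x \in H -> val (f x^-1%g) = (val (f x))^-1.
Proof.
move=> Hx; apply: (mulfI (fiber_neq0 (f x))).
by rewrite -homM ?groupV // mulgV hom1 divff ?fiber_neq0.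
Qed.

Lemma homX x k : x \in H -> val (f (x ^+ k)%g) = val (f x) ^+ k.
Proof.
move=> Hx; elim: k => [|k IHk]; first exact: hom1.
by rewrite expgS exprS homM ?groupX // IHk.
Qed.

Lemma homJ x y : y \in H -> val (f (x ^ y)%g) = val (f x).
Proof.
move=> Hy; have [Hx|Hx] := boolP (x \in H); last first.
  by rewrite !hom_out ?groupJr.
by rewrite conjgE !homM ?groupM ?groupV // homV // mulrCA mulVf ?fiber_neq0 ?mulr1.
Qed.

Definition hker := [set x in H | val (f x) == 1].

Lemma hker_group_set : group_set hker.
Proof.
apply/group_setP; split=> [|x y]; rewrite !inE ?group1 ?hom1 ?eqxx //.
move=> /andP[Hx /eqP fx] /andP[Hy /eqP fy].
by rewrite groupM // homM // fx fy mulr1 eqxx.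
Qed.

(** The values of [f] commute and are killed by [n]. *)
Lemma nresidual_hker : nresidual n H \subset hker.
Proof.
rewrite -[hker]/(gval (Group hker_group_set)) gen_subG subUset; apply/andP; split.
  rewrite gen_subG; apply/subsetP=> _ /imset2P[x y Hx Hy ->].
  by rewrite inE /= groupR // commgEl homM ?groupV ?groupJ // homJ // homV //
     mulVf ?fiber_neq0 /=.
apply/subsetP=> _ /imsetP[x Hx ->].
by rewrite inE /= groupX // homX // fiberX eqxx.
Qed.

Lemma hom_nresidual x : x \in nresidual n H -> val (f x) = 1.
Proof. by move/(subsetP nresidual_hker); rewrite inE => /andP[_ /eqP]. Qed.

(** Translating the summation variable by [y] multiplies the sum by [f y]. *)
Lemma sum_hom : \sum_(x in H) val (f x) = (f == hone)%:R * #|H|%:R.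
Proof.
have [->|/eqP neq_f1] := eqVneq.
  rewrite mul1r -sum1_card natr_sum; apply: eq_bigr => x _; exact: val_hone.
have [y Hy fy] : exists2 y, y \in H & val (f y) != 1.
  apply/exists_inP; apply: contra_notT neq_f1 => /exists_inPn f1.
  apply/ffunP=> x; apply/val_inj; rewrite val_hone.
  have [/f1|/hom_out//] := boolP (x \in H).
  by rewrite negbK => /eqP.
rewrite mul0r; apply/eqP; have: (val (f y) - 1) * (\sum_(x in H) val (f x)) == 0.
  rewrite mulrBl mul1r subr_eq0 mulr_sumr [eqbRHS](reindex_inj (mulgI y)) /=.
  apply/eqP/eq_big => x; first by rewrite groupMl.
  by move=> Hx; rewrite homM.
by rewrite mulf_eq0 subr_eq0 (negPf fy).
Qed.
End OneHom.

Lemma hom_orthogonality H p q : p \in homs H -> q \in homs H ->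
  \sum_(x in H) (val (q x))^-1 * val (p x) = (p == q)%:R * #|H|%:R.
Proof.
move=> Hp Hq; have Hr := hmul_homs (hinv_homs Hq) Hp.
rewrite -(inj_eq (can_inj (hmulKV (hinv q)))).
have -> : hmul (hinv q) q = hone.
  by apply/ffunP=> x; apply/val_inj; rewrite val_hmul val_hinv mulVf ?fiber_neq0 ?val_hone.
by rewrite -(sum_hom Hr); apply: eq_bigr => x _; rewrite val_hmul val_hinv.
Qed.

Lemma nresidual_over_normal H M :
  nresidual n H \subset M -> M \subset H -> (M <| H)%g.
Proof.
move=> sNM; apply: sub_der1_normal; apply: subset_trans sNM.
exact: subset_trans (subsetUl _ _) (subset_gen _).
Qed.

(** The quotient [H / M] is abelian, so its complex linear characters separate
    its elements; its exponent divides [n], so their values are [n]-th roots of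
    unity and can be transported from the field of algebraic numbers to [F],
    by matching powers of primitive [n]-th roots [w] and [z]. *)
Lemma hom_separation H M x : nresidual n H \subset M -> M \subset H ->
  x \in H -> x \notin M ->
  exists f, [/\ f \in homs H, {in M, forall m, val (f m) = 1} & val (f x) != 1].
Proof.
move=> sNM sMH Hx M'x; have nsMH := nresidual_over_normal sNM sMH.
have nMH := normal_norm nsMH.
have /andP[abQ expQ] : abelian (H / M)%g && (exponent (H / M)%g %| n)%N.
  by rewrite -nresidual_min.
have [w wP] := C_prim_root_exists (prim_order_gt0 zP).
have [i lin_i chix] : exists2 i : Iirr (H / M), 'chi_i \is a linear_char &
    'chi_i (coset M x) != 1.
  apply/exists_inP; apply: contraNT M'x => /exists_inPn chi1.
  apply: coset_idr; first exact: subsetP nMH x Hx.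
  apply/set1gP; rewrite -(derG1P abQ) -cap_cfker_lin_irr.
  apply/bigcapP=> i lin_i; rewrite cfkerEirr inE lin_char1 //.
  by rewrite -[_ == _]negbK chi1.
have chiX y : y \in H -> exists k : 'I_n, 'chi_i (coset M y) == w ^+ k.
  move=> Hy; have Qy: coset M y \in (H / M)%g by apply: mem_quotient.
  have [|k ->] := prim_rootP wP (x := 'chi_i (coset M y)); last by exists k.
  by rewrite -lin_charX // (exponentP expQ) // lin_char1.
pose k y := if [pick k : 'I_n | 'chi_i (coset M y) == w ^+ k] is Some k
            then k : nat else 0%N.
have chik y : y \in H -> 'chi_i (coset M y) = w ^+ k y.
  move=> Hy; rewrite /k; case: pickP => [j /eqP // | no].
  by have [j] := chiX y Hy; rewrite no.
pose f := [ffun y => if y \in H then fpow (k y) else fpow 0].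
have fE y : y \in H -> val (f y) = z ^+ k y by move=> Hy; rewrite ffunE Hy.
have zw a b : w ^+ a = w ^+ b -> z ^+ a = z ^+ b.
  move/eqP; rewrite (eq_prim_root_expr wP) => eqab.
  by apply/eqP; rewrite (eq_prim_root_expr zP).
exists f; split.
- apply/homsP; split=> [u v Hu Hv | u /negPf Hu]; last by rewrite ffunE Hu.
  rewrite /= !fE ?groupM // -exprD; apply: zw.
  rewrite -chik ?groupM // exprD -!chik // morphM ?(subsetP nMH) //.
  by rewrite lin_charM ?mem_quotient.
- move=> m Mm; have Hm := subsetP sMH m Mm.
  rewrite fE // -(expr0 z); apply: zw.
  by rewrite -chik // coset_id // lin_char1.
apply: contraNneq chix; rewrite fE // chik // -(expr0 z) => /eqP.
rewrite (eq_prim_root_expr zP) => eqk; rewrite -(expr0 w).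
by rewrite (eq_prim_root_expr wP).
Qed.

(** [Hom(H / M, C_n)], by inflation to [H]. *)
Definition homs_mod H M := [set f in homs H | [forall m in M, val (f m) == 1]].

Lemma homs_modP H M f :
  reflect (f \in homs H /\ {in M, forall m, val (f m) = 1}) (f \in homs_mod H M).
Proof.
apply: (iffP setIdP) => -[Hf fM]; split=> //.
  by move=> m Mm; apply/eqP/(forall_inP fM).
by apply/forall_inP=> m /fM->.
Qed.

(** Multiplying the summation variable by a [g] in [Hom(H / M, C_n)] with
    [g x != 1] shows that the sum is fixed under multiplication by [g x]. *)
Lemma sum_homs_mod_out H M x : nresidual n H \subset M -> M \subset H ->
  x \in H -> x \notin M -> \sum_(f in homs_mod H M) val (f x) = 0.
Proof.
move=> sNM sMH Hx M'x; have [g [Hg gM gx]] := hom_separation sNM sMH Hx M'x.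
apply/eqP; have: (val (g x) - 1) * (\sum_(f in homs_mod H M) val (f x)) == 0.
  rewrite mulrBl mul1r subr_eq0 mulr_sumr.
  rewrite [eqbRHS](reindex_inj (can_inj (hmulKV g))) /=.
  apply/eqP/eq_big => f; last by rewrite val_hmul.
  apply/homs_modP/homs_modP=> -[Hf fM]; split.
  - exact: hmul_homs.
  - by move=> m Mm; rewrite val_hmul gM // fM // mulr1.
  - by rewrite -(hmulKV g f); apply: hmul_homs => //; apply: hinv_homs.
  by move=> m Mm; have := fM m Mm; rewrite val_hmul gM // mul1r.
by rewrite mulf_eq0 subr_eq0 (negPf gx).
Qed.

(** Both sides, multiplied by [|M|], compute the sum of all [f x] with [x] in [H]
    and [f] in [Hom(H / M, C_n)]: summing over [f] first leaves the [x] in [M],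
    and summing over [x] first leaves only [f = 1]. *)
Lemma card_homs_mod H M : nresidual n H \subset M -> M \subset H ->
  #|homs_mod H M| = #|H : M|%g.
Proof.
move=> sNM sMH; apply/eqP; rewrite -(eqn_pmul2l (cardG_gt0 M)) Lagrange //.
rewrite -(eqr_nat F); apply/eqP.
transitivity (\sum_(x in H) \sum_(f in homs_mod H M) val (f x)).
  rewrite (big_setID M) /= [X in _ = _ + X]big1 ?addr0 => [|x]; last first.
    by rewrite inE => /andP[M'x Hx]; apply: sum_homs_mod_out.
  rewrite (setIidPr sMH) natrM mulr_natl -sumr_const; apply: eq_bigr => x Mx.
  rewrite (eq_bigr (fun=> 1)) ?sumr_const // => f /homs_modP[_ ->] //.
rewrite exchange_big /= (bigD1 hone) /=; last first.
  by apply/homs_modP; split=> [|m _]; rewrite ?hone_homs ?val_hone.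
rewrite (sum_hom (hone_homs H)) eqxx mul1r big1 ?addr0 // => f /andP[].
by case/homs_modP=> Hf _ /negPf neq1; rewrite (sum_hom Hf) neq1 mul0r.
Qed.

Lemma sum_homs_mod H M x : nresidual n H \subset M -> M \subset H -> x \in H ->
  \sum_(f in homs_mod H M) val (f x) = (x \in M)%:R * #|H : M|%g%:R.
Proof.
move=> sNM sMH Hx; have [Mx|M'x] := boolP (x \in M); last first.
  by rewrite mul0r; apply: sum_homs_mod_out.
rewrite mul1r -card_homs_mod // -sumr_const; apply: eq_bigr => f.
by case/homs_modP=> _ ->.
Qed.

Lemma sum_homs H x : x \in H ->
  \sum_(f in homs H) val (f x) =
    (x \in nresidual n H)%:R * #|H : nresidual n H|%g%:R.
Proof.
move=> Hx; rewrite -[RHS](@sum_homs_mod H (nresidual_group n H)) //; last first.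
  by rewrite normal_sub ?nresidual_normal.
apply: eq_bigl => f; apply/idP/homs_modP=> [Hf | []//]; split=> // m.
exact: hom_nresidual.
Qed.

Definition hres K f : {ffun gT -> fiber z n} :=
  [ffun x => if x \in K then f x else fpow 0].

Lemma hres_homs H K f : K \subset H -> f \in homs H -> hres K f \in homs K.
Proof.
move=> sKH Hf; apply/homsP; split=> [x y Kx Ky|x /negPf K'x]; last by rewrite ffunE K'x.
by rewrite /= !ffunE Kx Ky groupM // (homM Hf) ?(subsetP sKH).
Qed.

Lemma hres_eqP K p q : reflect {in K, p =1 q} (hres K p == hres K q).
Proof.
apply: (iffP eqP) => [/ffunP eqpq x Kx | eqpq].
  by have := eqpq x; rewrite !ffunE Kx.
by apply/ffunP=> x; rewrite !ffunE; case: ifP => // /eqpq.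
Qed.

(** The homomorphisms that agree with [p] on [K] are the products of [p] by
    elements of [Hom(H / KN, C_n)]. *)
Lemma sum_hres_fiber H K h p : K \subset H -> h \in H -> p \in homs H ->
  \sum_(f in homs H | hres K f == hres K p) (val (f h))^-1 =
    (h \in K <*> nresidual n H)%g%:R * #|H : K <*> nresidual n H|%g%:R * (val (p h))^-1.
Proof.
move=> sKH Hh Hp; set M := (K <*> nresidual n H)%G.
have sNM : nresidual n H \subset M by apply: joing_subr.
have sMH : M \subset H by rewrite join_subG sKH normal_sub ?nresidual_normal.
have hmulK f : hmul p f \in homs H -> f \in homs H.
  by move=> Hpf; rewrite -(hmulKV p f); apply: hmul_homs => //; apply: hinv_homs.
rewrite -[(h \in _)%g]groupV -(sum_homs_mod sNM sMH (groupVr Hh)).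
rewrite mulr_suml (reindex_inj (can_inj (hmulKV p))) /=.
apply: eq_big => f; last first.
  by case/andP=> /hmulK Hf _; rewrite val_hmul invfM mulrC (homV Hf).
apply/andP/homs_modP=> [[/hmulK Hf /hres_eqP eqp] | [Hf fM]]; last first.
  split; first exact: hmul_homs.
  apply/hres_eqP=> x Kx; apply/val_inj; rewrite val_hmul fM ?mulr1 //.
  by rewrite (subsetP (joing_subl _ _)).
split=> //; suff sMf : M \subset Group (hker_group_set Hf).
  by move=> m /(subsetP sMf); rewrite inE => /andP[_ /eqP].
rewrite join_subG [_ \subset _ in X in _ && X]nresidual_hker // andbT.
apply/subsetP=> x Kx; rewrite inE (subsetP sKH) //=.
apply/eqP/(mulfI (fiber_neq0 (p x))); rewrite mulr1 -val_hmul.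
by rewrite eqp.
Qed.

End Homs.

(** * Species determine elements *)

Section Species.
Variables (F : numFieldType) (z : F) (n : nat).
Hypothesis zP : n.-primitive_root z.
Variables (gT : finGroupType) (G : {group gT}).
Implicit Types (H K L M : {group gT}) (p q : fpair z n gT).

Lemma forbit_frep (o : {o | o \in forbits z n G}) :
  frep o \in fpairs z n G /\ forbit G (frep o) = val o.
Proof. by have /andP[Mp /eqP] := xchooseP (forbit_rep o). Qed.

Lemma fconj1 p : fconj 1 p = p.
Proof.
case: p => K f; congr (_, _); first by apply/val_inj; rewrite /= invg1 conjsg1.
by apply/ffunP=> x; rewrite ffunE conjg1.
Qed.

Lemma forbit_fconj p g : g \in G -> forbit G (fconj g p) = forbit G p.
Proof.
move=> Gg; apply/setP=> q; apply/imsetP/imsetP=> -[a Ga ->].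
  by exists (a * g)%g; rewrite ?groupM ?fconjM.
by exists (a * g^-1)%g; rewrite ?groupM ?groupV // fconjM mulgKV.
Qed.

(** Summing over elements of [G] instead of cosets turns the action of coset
    representatives into a plain conjugation. *)
Lemma fspecies_pairE L l p : p \in fpairs z n G ->
  #|p.1|%:R * fspecies_pair G L l p =
    \sum_(g in G | L \subset (fconj g p).1) val ((fconj g p).2 l).
Proof.
move=> Mp; rewrite /fspecies_pair mulr_sumr.
rewrite (partition_big (fun g => (g *: p.1)%g)
   (fun A => (A \in lcosets p.1 G) && (L \subset (fconj (repr A) p).1))); last first.
  move=> g /andP[Gg sL]; apply/andP; split; first by apply/lcosetsP; exists g.
  by rewrite (fconj_lcoset Mp (erefl (g *: p.1)%g)).
apply: eq_bigr => A /andP[/lcosetsP[a Ga defA] sLA].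
have inA g : (g *: p.1 == A)%g = (g \in A).
  rewrite defA eq_sym; apply/eqP/idP=> [->|]; first exact: lcoset_refl.
  by move/lcoset_eqP=> ->.
rewrite (eq_bigr (fun=> val ((fconj (repr A) p).2 l))); last first.
  by move=> g /andP[_ /eqP defgA]; rewrite (fconj_lcoset Mp (esym defgA)).
rewrite sumr_const -[RHS]mulr_natl -(card_lcoset p.1 a) -defA; congr (_%:R * _).
apply: eq_card => g; rewrite [RHS]unfold_in -inA.
case: eqP => [defgA|_]; last by rewrite andbF.
rewrite andbT -(fconj_lcoset Mp (esym defgA)) sLA andbT.
symmetry; move/eqP: defgA; rewrite inA defA => /lcosetP[k pk ->].
by rewrite groupM //; move: Mp; rewrite inE => /and3P[/subsetP->].
Qed.

(** Let [o] be an orbit in the support of [x] whose representative [(H, f)] has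
    [|H|] maximal.  Then [H <= gK] forces [H = gK] for all pairs [(K, q)] in the
    support, and orthogonality of characters applied to the vanishing species
    at [H] isolates the coefficient of [o], multiplied by the nonzero number of
    [g] in [G] that stabilize [(H, f)]. *)
Lemma fspecies_inj (x : fburnside z n G) :
  (forall H h, H \subset G -> h \in H -> fspecies H h x = 0) -> x = 0.
Proof.
move=> x0; apply/ffunP=> o0; rewrite ffunE; apply: contraTeq isT => nz0.
have := @arg_maxnP _ o0 (fun o => x o != 0) (fun o => #|(frep o).1|) nz0.
case=> o nzo max_o; case def_p: (frep o) (forbit_frep o) => [H f] [Mp def_o].
have := Mp; rewrite fpairsE => /andP[sHG Hf].
have key o' l : x o' * fspecies_pair G H l (frep o') =
    x o' * (#|H|%:R^-1 * \sum_(g in G | (fconj g (frep o')).1 == H)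
                            val ((fconj g (frep o')).2 l)).
  have [->|nzx] := eqVneq (x o') 0; first by rewrite !mul0r.
  have [Mq _] := forbit_frep o'; congr (_ * _).
  have q0 : #|(frep o').1|%:R != 0 :> F by rewrite pnatr_eq0 -lt0n.
  rewrite -[LHS](mulKf q0) fspecies_pairE //.
  have le_oH : (#|(frep o').1| <= #|H|)%N by have := max_o o' nzx; rewrite def_p.
  have eqsub g : (H \subset (fconj g (frep o')).1) = ((fconj g (frep o')).1 == H).
    apply/idP/eqP=> [sH | -> //]; apply/val_inj/esym/eqP.
    by rewrite eqEcard sH /= cardJg.
  rewrite (eq_bigl _ _ (fun g => congr1 (andb _) (eqsub g))).
  have [g /andP[_ /eqP defH] | none] := pickP [pred g in G | (fconj g (frep o')).1 == H].
    by congr (_%:R^-1 * _); rewrite -defH /= cardJg.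
  by rewrite !big_pred0 ?mulr0.
have sum0 : \sum_(l in H) (val (f l))^-1 * fspecies H l x = 0.
  by apply: big1 => l Hl; rewrite x0 ?mulr0.
have H0 : #|H|%:R != 0 :> F by rewrite pnatr_eq0 -lt0n.
have orth (o' : {o | o \in forbits z n G}) g : g \in G -> (fconj g (frep o')).1 == H ->
    \sum_(l in H) (val (f l))^-1 * val ((fconj g (frep o')).2 l) =
      (fconj g (frep o') == frep o)%:R * #|H|%:R.
  move=> Gg /eqP defH; have [Mq _] := forbit_frep o'.
  have := fconj_fpairs Gg Mq; rewrite def_p.
  case: (fconj g _) defH => K f' /= ->{K}; rewrite fpairsE => /andP[_ Hf'].
  by rewrite (hom_orthogonality zP Hf' Hf) xpair_eqE eqxx.
have stab (o' : {o | o \in forbits z n G}) : \sum_(g in G) (fconj g (frep o') == frep o)%:R =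
    (o' == o)%:R * \sum_(g in G) (fconj g (frep o) == frep o)%:R :> F.
  have [->|neq] := eqVneq o' o; first by rewrite mul1r.
  rewrite mul0r; apply: big1 => g Gg; case: eqP => // eqo.
  case/eqP: neq; apply/val_inj; have [_ <-] := forbit_frep o'.
  by rewrite -(forbit_fconj _ Gg) eqo; case: (forbit_frep o).
have : x o * \sum_(g in G) (fconj g (frep o) == frep o)%:R = 0 :> F.
  apply: etrans sum0; rewrite /fspecies; symmetry.
  under eq_bigr do rewrite mulr_sumr.
  rewrite exchange_big /=.
  transitivity (\sum_o' x o' * \sum_(g in G) (fconj g (frep o') == frep o)%:R).
    apply: eq_bigr => o' _.
    have perm (a b c d : F) : a * (b * (c * d)) = b * (c * (a * d)).
      by rewrite mulrCA (mulrCA a).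
    under eq_bigr => l _ do rewrite key perm mulr_sumr.
    rewrite -!mulr_sumr exchange_big /=; congr (_ * _).
    apply: (mulfI H0); rewrite mulVKf // mulr_sumr big_mkcondr /=.
    apply: eq_bigr => g Gg; case: ifP => [defH|neqH].
      by rewrite mulrC -orth.
    case: eqP => [eqo|]; last by rewrite mulr0.
    by move: neqH; rewrite -[_ == H]/((fconj g (frep o')).1 == H) eqo def_p eqxx.
  rewrite (bigD1 o) //= [X in _ + X]big1 ?addr0 // => o' /negPf neq.
  by rewrite stab neq mul0r mulr0.
move/eqP; apply: contraLR => _; rewrite mulf_neq0 // -natr_sum pnatr_eq0 sum_nat_eq0.
apply/forall_inPn; exists 1%g => //.
by rewrite fconj1 eqxx.
Qed.

End Species.

(** * The explicit multiple of the idempotent *)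

Section Idempotent.
Variables (F : numFieldType) (z : F) (n : nat).
Hypothesis zP : n.-primitive_root z.
Variables (gT : finGroupType) (G : {group gT}).
Implicit Types (K L M : {group gT}) (p q : fpair z n gT).

Lemma nresidualJ K x : (nresidual n (K :^ x) = nresidual n K :^ x)%g.
Proof.
rewrite /nresidual -genJ conjUg -[in RHS]derJ; congr <<_ :|: _>>%g.
apply/setP=> y; rewrite mem_conjg; apply/imsetP/imsetP=> [[u Hu ->]|[u Hu def_y]].
  by exists (u ^ x^-1)%g; rewrite ?conjXg // -mem_conjg.
exists (u ^ x)%g; first by rewrite memJ_conjg.
by rewrite -conjXg -def_y conjgKV.
Qed.

Variables (H : {group gT}) (h : gT).
Hypotheses (sHG : H \subset G) (Hh : h \in H).
Local Notation N := (nresidual n H).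

(** The [g] in [G] that carry the pair [(L, l nresidual(L))] to [(H, hN)]. *)
Definition transporter L (l : gT) : {set gT} :=
  [set g in G | (L :^ g == H)%g && (l ^ g \in h *: N)%g].

(** Since [H / N] is abelian, conjugation by elements of [N] fixes the coset
    [hN]. *)
Lemma sub_nres_Dstab : N \subset Dstab n G H h.
Proof.
have sNH := normal_sub (nresidual_normal n H).
apply/subsetP=> x Nx; have Hx := subsetP sNH x Nx.
rewrite 2!inE (subsetP sHG) //= (subsetP (normG H)) //=.
rewrite inE; apply/subsetP=> _ /imsetP[_ /lcosetP[y Ny ->] ->].
have -> : ((h * y) ^ x = h * ((x^-1) ^ h * (y * x)))%g by rewrite !conjgE !mulgA mulgV mul1g.
rewrite mem_lcoset mulKg; apply: (@groupM _ [group of N]); last exact: groupM.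
have /andP[_ nNH] := nresidual_normal n H.
by rewrite memJ_norm ?groupV // (subsetP nNH).
Qed.

Lemma transporter_lcoset L l g : g \in transporter L l ->
  transporter L l = (g *: Dstab n G H h)%g.
Proof.
rewrite inE => /and3P[Gg /eqP defH Nlg].
have lg_coset : (l ^ g *: N = h *: N)%g.
  by apply/(@lcoset_eqP _ [group of N]).
apply/setP=> x; rewrite mem_lcoset [LHS]inE [RHS]in_setI in_setI groupMl ?groupV //.
have [Gx|] //= := boolP (x \in G).
have eqH : (L :^ x == H)%g = (g^-1 * x \in 'N(H))%g.
  by apply/eqP/normP; rewrite conjsgM -defH conjsgK.
rewrite -eqH; case: eqP => //= defHx.
have nNx : (N :^ (g^-1 * x) = N)%g.
  rewrite -nresidualJ; congr nresidual.
  by apply/normP; rewrite -eqH defHx.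
rewrite [RHS]inE -lg_coset.
have -> : ((l ^ g *: N) :^ (g^-1 * x) = l ^ x *: N)%g.
  by rewrite conjsMg nNx conjg_set1 -conjgM mulKVg.
rewrite lg_coset; apply/idP/subsetP=> [Nlx|].
  by have -> : (l ^ x *: N = h *: N)%g by apply/(@lcoset_eqP _ [group of N]).
by apply; apply: (@lcoset_refl _ [group of N]).
Qed.

Lemma transporter_neq0 L l : L \subset G -> l \in L ->
  (transporter L l != set0) = (Dorbit n G L l == Dorbit n G H h).
Proof.
move=> sLG Ll.
have orb g : g \in G -> (g \in transporter L l) =
    ((L :^ g, (l *: nresidual n L) :^ g) == (H : {set gT}, h *: N))%g.
  move=> Gg; rewrite inE Gg xpair_eqE /=; case: eqP => //= defH.
  rewrite conjsMg conjg_set1 -nresidualJ.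
  have -> : nresidual n (L :^ g)%g = N by rewrite defH.
  apply/idP/eqP=> [|<-]; last exact: (@lcoset_refl _ [group of N]).
  by move/(@lcoset_eqP _ [group of N]).
apply/set0Pn/eqP=> [[g Dg] | eqD].
  have Gg : g \in G by move: Dg; rewrite inE => /andP[].
  move: Dg; rewrite orb // => /eqP[defH defhN].
  apply/setP=> q; apply/imsetP/imsetP=> -[a Ga ->{q}].
    exists (a * g)%g; first exact: groupM.
    by rewrite -defhN -defH -!conjsgM invMg mulKVg.
  exists (a * g^-1)%g; first by rewrite groupM ?groupV.
  by rewrite -defhN -defH -!conjsgM invMg invgK.
have: (H : {set gT}, h *: N)%g \in Dorbit n G L l.
  by rewrite eqD; apply/imsetP; exists 1%g => //; rewrite invg1 !conjsg1.
case/imsetP=> g Gg eqg; exists g^-1%g; rewrite orb ?groupV //; apply/eqP.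
by rewrite -eqg.
Qed.

(** The coefficients that Moebius inversion over subgroups and Fourier inversion
    over [Hom(H, C_n)] assign to the indicator function of the orbit of
    [(H, hN)], scaled by [[N_G(H, hN) : N]]. *)
Definition idem_coef K (f : {ffun gT -> fiber z n}) : F :=
  (mobius K H)%:~R * #|K|%:R / #|H|%:R * (val (f h))^-1.

Definition scaled_idem : fburnside z n G :=
  [ffun o => \sum_(K : {group gT} | K \subset H) \sum_(f in homs z n H)
     idem_coef K f * fbasis G (K, hres zP K f) o].

(** The sum over [K] between [L ^ g] and [H] of [mu(K, H)] forces [L ^ g = H];
    the sum over [Hom(H, C_n)] of the values at [h^-1 l^g] then forces
    [l ^ g] to lie in [hN]. *)
Lemma fspecies_scaled_idem L l : L \subset G -> l \in L ->
  fspecies L l scaled_idem = #|transporter L l|%:R / #|N|%:R.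
Proof.
move=> sLG Ll; pose A g := \sum_(f in homs z n H) (val (f h))^-1 * val (f (l ^ g)%g).
have H0 : #|H|%:R != 0 :> F by rewrite pnatr_eq0 -lt0n.
transitivity (\sum_(K : {group gT} | K \subset H)
    (mobius K H)%:~R / #|H|%:R * \sum_(g in G | (L :^ g \subset K)%g) A g).
  rewrite /fspecies; under eq_bigr => o _ do rewrite ffunE mulr_suml.
  rewrite exchange_big /=; apply: eq_bigr => K sKH.
  under eq_bigr => o _ do rewrite mulr_suml.
  rewrite exchange_big /= [in RHS]/A [X in _ = _ * X]exchange_big mulr_sumr /=.
  apply: eq_bigr => f Hf.
  have Mp : (K, hres zP K f) \in fpairs z n G.
    by rewrite fpairsE (subset_trans sKH) // (hres_homs zP sKH).
  under eq_bigr => o _ do rewrite -mulrA.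
  rewrite -mulr_sumr -/(fspecies L l _) fspecies_basis //.
  have K0 : #|K|%:R != 0 :> F by rewrite pnatr_eq0 -lt0n.
  have -> : fspecies_pair G L l (K, hres zP K f) = #|K|%:R^-1 *
      \sum_(g in G | (L :^ g \subset K)%g) val (f (l ^ g)%g).
    rewrite -[LHS](mulKf K0) (fspecies_pairE _ _ Mp); congr (_ * _).
    have sLK g : (L \subset K :^ g^-1)%g = (L :^ g \subset K)%g.
      by rewrite -(conjSg _ _ g) conjsgKV.
    apply: eq_big => g; first by rewrite -sLK.
    case/andP=> _ /=; rewrite sLK => /subsetP sLgK.
    by rewrite !ffunE sLgK ?memJ_conjg.
  rewrite -mulr_sumr /idem_coef !mulrA; congr (_ * _).
  by rewrite [LHS]mulrC !mulrA [_ * (mobius K H)%:~R]mulrC mulfVK.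
under eq_bigr do rewrite mulr_sumr.
rewrite (exchange_big_dep (mem G)) /=; last by move=> K g _ /andP[].
transitivity (\sum_(g in transporter L l) (#|N|%:R)^-1 : F); last first.
  by rewrite sumr_const -[LHS]mulr_natl.
rewrite [RHS]big_mkcond [LHS]big_mkcond /=; apply: eq_bigr => g _.
rewrite inE; have [Gg|] //= := boolP (g \in G).
have [sLgH|not_sLgH] := boolP (L :^ g \subset H)%g; last first.
  rewrite big_pred0 => [|K].
    by case: eqP not_sLgH => //= ->; rewrite subxx.
  apply: contraNF not_sLgH => /andP[sKH]; rewrite /= => sLK.
  exact: subset_trans sLK sKH.
rewrite (eq_bigl (fun K : {group gT} => ((L :^ g)%G \subset K) && (K \subset H))); last first.
  by move=> K; rewrite andbC.
rewrite -2!mulr_suml -rmorph_sum /= sum_mobius //.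
rewrite -val_eqE /=; case: eqP => [defH|_]; last by rewrite !mul0r.
have Hlg : (l ^ g)%g \in H by rewrite -defH memJ_conjg.
rewrite mul1r /A /=.
under eq_bigr => f Hf do rewrite -(homV zP Hf) // -(homM Hf) ?groupV //.
have Hhl : (h^-1 * l ^ g)%g \in H by rewrite groupM ?groupV.
rewrite (sum_homs zP Hhl) mem_lcoset.
case: ifP => _; last by rewrite mul0r mulr0.
rewrite mul1r -(Lagrange (normal_sub (nresidual_normal n H))) natrM invfM.
by rewrite mulfVK // pnatr_eq0 -lt0n indexg_gt0.
Qed.

End Idempotent.

(** * Integrality *)

Section Adj.
Variables (F : numFieldType) (z : F).

Lemma in_ZadjD a b : in_Zadj z a -> in_Zadj z b -> in_Zadj z (a + b).
Proof. by move=> [p ->] [q ->]; exists (p + q); rewrite rmorphD hornerD. Qed.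

Lemma in_ZadjM a b : in_Zadj z a -> in_Zadj z b -> in_Zadj z (a * b).
Proof. by move=> [p ->] [q ->]; exists (p * q); rewrite rmorphM hornerM. Qed.

Lemma in_Zadj_int (m : int) : in_Zadj z m%:~R.
Proof. by exists m%:P; rewrite map_polyC hornerC. Qed.

Lemma in_Zadj_exp k : in_Zadj z (z ^+ k).
Proof. by exists 'X^k; rewrite map_polyXn hornerXn. Qed.

Lemma in_QadjD a b : in_Qadj z a -> in_Qadj z b -> in_Qadj z (a + b).
Proof. by move=> [p ->] [q ->]; exists (p + q); rewrite rmorphD hornerD. Qed.

Lemma in_QadjM a b : in_Qadj z a -> in_Qadj z b -> in_Qadj z (a * b).
Proof. by move=> [p ->] [q ->]; exists (p * q); rewrite rmorphM hornerM. Qed.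

Lemma in_Qadj_rat (r : rat) : in_Qadj z (ratr r).
Proof. by exists r%:P; rewrite map_polyC hornerC. Qed.

Lemma in_Qadj_nat m : in_Qadj z m%:R.
Proof. by rewrite -(ratr_nat F); apply: in_Qadj_rat. Qed.

Lemma in_Qadj_natV m : in_Qadj z m%:R^-1.
Proof. by rewrite -(ratr_nat F) -fmorphV; apply: in_Qadj_rat. Qed.

Lemma in_Qadj_int (m : int) : in_Qadj z m%:~R.
Proof. by rewrite -(ratr_int F); apply: in_Qadj_rat. Qed.

Lemma in_Qadj_exp k : in_Qadj z (z ^+ k).
Proof. by exists 'X^k; rewrite map_polyXn hornerXn. Qed.
End Adj.

Section Integrality.
Variables (F : numFieldType) (z : F) (n : nat).
Hypothesis zP : n.-primitive_root z.
Variables (gT : finGroupType) (G : {group gT}).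
Implicit Types (K L M : {group gT}).
Variables (H : {group gT}) (h : gT).
Hypotheses (sHG : H \subset G) (Hh : h \in H).
Local Notation N := (nresidual n H).
Local Notation scaled_idem := (scaled_idem zP G H h).

Lemma in_Qadj_scaled_idem o : in_Qadj z (scaled_idem o).
Proof.
have Q0 : in_Qadj z 0 by apply: (in_Qadj_nat z 0).
rewrite ffunE; apply: big_ind => [||K sKH] //; first exact: in_QadjD.
apply: big_ind => [||f Hf] //; first exact: in_QadjD.
apply: in_QadjM; last by rewrite ffunE; apply: in_Qadj_nat.
rewrite /idem_coef -(homV zP Hf) //; have [k ->] := fiberP (f h^-1%g).
apply: in_QadjM; last exact: in_Qadj_exp.
apply: in_QadjM; last exact: in_Qadj_natV.
by apply: in_QadjM; [apply: in_Qadj_int | apply: in_Qadj_nat].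
Qed.

(** The coefficient at [o] of the sum of the [phi(h)^-1 [K, phi|_K]] over [phi]
    in [Hom(H, C_n)]. *)
Definition orbit_sum (o : {o | o \in forbits z n G}) K : F :=
  \sum_(f in homs z n H | val o == forbit G (K, hres zP K f)) (val (f h))^-1.

(** Whether [phi] occurs in the sum depends only on its restriction to [K], so
    the sum splits into those of [sum_hres_fiber]. *)
Lemma orbit_sum_dvd o K : K \subset H ->
  exists2 t, in_Zadj z t & orbit_sum o K = #|H : K <*> N|%g%:R * t.
Proof.
move=> sKH; pose P y := exists2 t, in_Zadj z t & y = #|H : K <*> N|%g%:R * t :> F.
have P0 : P 0 by exists 0; rewrite ?mulr0 //; apply: (in_Zadj_int z 0).
have PD y1 y2 : P y1 -> P y2 -> P (y1 + y2).
  move=> [t1 Zt1 ->] [t2 Zt2 ->]; exists (t1 + t2); first exact: in_ZadjD.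
  by rewrite mulrDr.
rewrite -/(P _) /orbit_sum (partition_big (hres zP K) predT) //=.
apply: big_ind => // q _.
have [p /and3P[Hp op /eqP qp] | none] := pickP [pred f |
    [&& f \in homs z n H, val o == forbit G (K, hres zP K f) & hres zP K f == q]]; last first.
  by rewrite big_pred0 // => f; rewrite -andbA; apply: none.
rewrite (eq_bigl (fun f => (f \in homs z n H) && (hres zP K f == hres zP K p))); last first.
  move=> f; rewrite -qp -andbA; congr (_ && _).
  by apply: andb_idl => /eqP->.
rewrite (sum_hres_fiber zP sKH Hh Hp) -(homV zP Hp) //.
have [k ->] := fiberP (p h^-1%g).
exists ((h \in K <*> N)%g%:R * z ^+ k); last by rewrite mulrCA mulrA.
by apply: in_ZadjM; [apply: (in_Zadj_int z (Posz _)) | apply: in_Zadj_exp].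
Qed.

(** Homomorphisms on [H] are invariant under conjugation by [x] in [H], so
    [x^-1] conjugates [(K, phi|_K)] to the pair of the conjugate subgroup. *)
Lemma orbit_sumJ o K x : x \in H -> orbit_sum o (K :^ x)%G = orbit_sum o K.
Proof.
move=> Hx; apply: eq_bigl => f; apply: andb_id2l => Hf.
have Gx : x^-1%g \in G by rewrite groupV (subsetP sHG).
rewrite -[forbit G (K, _)](forbit_fconj _ Gx); congr (_ == forbit G _).
congr (_, _); first by apply/val_inj; rewrite /= invgK.
apply/ffunP=> y; rewrite !ffunE /= -mem_conjg; case: ifP => // _.
by apply/val_inj; rewrite (homJ zP Hf) ?groupV.
Qed.

(** A prime dividing [[H : H'K] = [H : KN] [KN : H'K]] divides one of the two
    factors, and [[KN : H'K] = [N : N :&: H'K]] divides [[N : H']]. *)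
Lemma index_squarefree_dvd K : K \subset H ->
  (squarefree_part #|H : H^`(1) <*> K|%g %|
     #|H : K <*> N|%g * squarefree_part #|N : H^`(1)|%g)%N.
Proof.
move=> sKH; have nsNH := nresidual_normal n H.
have sH'N : H^`(1)%g \subset N.
  exact: subset_trans (subsetUl _ _) (subset_gen _).
have sNH := normal_sub nsNH.
have nNK : (H^`(1) <*> K \subset 'N(N))%g.
  by rewrite (subset_trans _ (normal_norm nsNH)) // join_subG der_sub.
apply: squarefree_part_dvdP => p pr_p _.
have eM : (K <*> N = (H^`(1) <*> K) * N)%g.
  rewrite -norm_joinEl //= (joingC _ K) -joingA.
  by have -> : (H^`(1) <*> N = N)%g by apply/joing_idPr.
have sM : (H^`(1) <*> K \subset K <*> N)%g.
  by rewrite eM mulG_subl.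
have sMH : (K <*> N \subset H)%g by rewrite join_subG sKH.
rewrite -(Lagrange_index sMH sM) Euclid_dvdM // => /orP[/dvdn_mulr-> // | ].
rewrite /= eM indexMg => pN; apply: dvdn_mull; apply: dvdn_squarefree_part => //.
by apply: dvdn_trans pN _; apply: indexgS; apply: joing_subl.
Qed.

(** The conjugates of [K] in [H] together contribute [mu(K, H) / [N_H(K) : K]]
    times the sum of [orbit_sum_dvd], whose factor [[H : KN]] together with [m]
    makes up for the denominator. *)
Theorem scaled_idem_integral o :
  in_Zadj z (scaled_idem o *+ squarefree_part #|N : H^`(1)|%g).
Proof.
set m := squarefree_part _.
have H0 : #|H|%:R != 0 :> F by rewrite pnatr_eq0 -lt0n.
pose u K : F := (mobius K H)%:~R * #|K|%:R / #|H|%:R * orbit_sum o K * m%:R.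
have -> : scaled_idem o *+ m = \sum_(K : {group gT} | K \subset H) u K.
  rewrite ffunE -sumrMnl; apply: eq_bigr => K sKH.
  rewrite -mulr_natr /u; congr (_ * _); rewrite /orbit_sum mulr_sumr big_mkcondr.
  apply: eq_bigr => f Hf; rewrite ffunE /idem_coef.
  by case: eqP => _; rewrite ?mulr1 ?mulr0.
apply: (@sum_conj_invariant _ _ (in_Zadj z) H).
- exact: (in_Zadj_int z 0).
- exact: in_ZadjD.
- by move=> K x Hx sKH; rewrite -(conjGid Hx) conjSg.
- move=> K x Hx _; rewrite /u mobiusJ ?(subsetP (normG H)) //= cardJg.
  by rewrite orbit_sumJ.
move=> K sKH; have [t Zt eT] := orbit_sum_dvd o sKH.
set i := #|H : K <*> N|%g in eT.
have /dvdnP[c eqc] : (#|'N_H(K) : K|%g %| `|mobius K H| * (i * m))%N.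
  apply: dvdn_trans (mobius_index_dvd sKH) _; apply: dvdn_mul => //.
  exact: index_squarefree_dvd.
have {eqc} [d eqd] : exists d : int, mobius K H * (i * m)%:Z = d * #|'N_H(K) : K|%g%:Z.
  exists (sgz (mobius K H) * c%:Z).
  by rewrite -mulrA -PoszM -eqc [in LHS](intEsg (mobius K H)) -mulrA -PoszM.
suff -> : u K *+ #|H : 'N_H(K)|%g = d%:~R * t.
  by apply: in_ZadjM => //; apply: in_Zadj_int.
have K0 : #|K|%:R != 0 :> F by rewrite pnatr_eq0 -lt0n.
have sKNK : K \subset 'N_H(K)%g by rewrite subsetI sKH normG.
have I0 : #|'N_H(K) : K|%g%:R != 0 :> F by rewrite pnatr_eq0 -lt0n indexg_gt0.
have J0 : #|H : 'N_H(K)|%g%:R != 0 :> F by rewrite pnatr_eq0 -lt0n indexg_gt0.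
have cH : #|H|%:R = #|K|%:R * #|'N_H(K) : K|%g%:R * #|H : 'N_H(K)|%g%:R :> F.
  by rewrite -!natrM (Lagrange sKNK) (Lagrange (subsetIl H 'N(K)%g)).
have eqd' : (mobius K H)%:~R * (i%:R * m%:R) = d%:~R * #|'N_H(K) : K|%g%:R :> F.
  by have := congr1 (intmul (1 : F)) eqd; rewrite PoszM !intrM.
have -> : d%:~R = (mobius K H)%:~R * (i%:R * m%:R) / #|'N_H(K) : K|%g%:R :> F.
  by rewrite eqd' mulfK.
rewrite /u eT cH -[_ *+ #|H : _|%g]mulr_natr.
move: K0 I0 J0 => /= K0 I0 J0; field.
by rewrite I0 J0 K0.
Qed.
End Integrality.

Theorem proposition5p5 (R : realType) (gT : finGroupType) (G : {group gT})
    (n : nat) (n_gt0 : (0 < n)%N) (n_dvd : (n %| exponent G)%N)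
    (H : {group gT}) (sHG : H \subset G) (h : gT) (Hh : h \in H) :
  exists e : fburnside (zeta R n) n G,
    unique (is_primitive_idempotent H h) e /\
    fburnside_over (in_Zadj (zeta R n))
      (e *+ (#|Dstab n G H h : nresidual n H|%g
             * squarefree_part #|nresidual n H : H^`(1)|%g)).
Proof.
have zP := zeta_prim R n_gt0.
set i := #|Dstab n G H h : _|%g; set m := squarefree_part _.
have sNS := sub_nres_Dstab n sHG Hh.
have i0 : i%:R != 0 :> R[i] by rewrite pnatr_eq0 -lt0n indexg_gt0.
pose e : fburnside (zeta R n) n G := [ffun o => scaled_idem zP G H h o / i%:R].
have specE (L : {group gT}) (l : gT) : L \subset G -> l \in L ->
    fspecies L l e = (Dorbit n G L l == Dorbit n G H h)%:R.
  move=> sLG Ll.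
  have -> : fspecies L l e = fspecies L l (scaled_idem zP G H h) / i%:R.
    rewrite /fspecies mulr_suml; apply: eq_bigr => o _.
    by rewrite [e o]ffunE mulrAC.
  rewrite fspecies_scaled_idem // -transporter_neq0 //.
  have [->|[g Dg]] := set_0Vmem (transporter n G H h L l).
    by rewrite cards0 !mul0r eqxx.
  have -> : (transporter n G H h L l != set0) = true by apply/set0Pn; exists g.
  rewrite (transporter_lcoset Dg) card_lcoset -(Lagrange sNS) natrM.
  have N0 : #|nresidual n H|%:R != 0 :> R[i].
    by rewrite pnatr_eq0 -lt0n (cardG_gt0 [group of nresidual n H]).
  by rewrite [_ * i%:R]mulrC mulfK // divff.
exists e; split.
  split.
    split=> [o|L l]; last exact: specE.
    rewrite ffunE; apply: in_QadjM; last exact: in_Qadj_natV.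
    exact: in_Qadj_scaled_idem.
  move=> e' [_ spec']; apply/eqP; rewrite -subr_eq0; apply/eqP.
  apply: (fspecies_inj zP) => L l sLG Ll.
  transitivity (fspecies L l e - fspecies L l e'); last first.
    by rewrite specE // spec' // subrr.
  rewrite /fspecies -sumrB; apply: eq_bigr => o _.
  by rewrite !ffunE mulrBl.
move=> o; have := scaled_idem_integral zP sHG Hh o; rewrite -/m.
have -> // : (e *+ (i * m)) o = scaled_idem zP G H h o *+ m.
rewrite mulrnA !ffunMnE; congr (_ *+ m).
by rewrite [e o]ffunE -[LHS]mulr_natr mulfVK.
Qed.
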